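(* Let $X$ be a completely regular space, let $\{f_U\colon U\in\operatorname{RO}(X)\}$ be an $\operatorname{RO}(X)$-stratification, and for $U\in\operatorname{RO}(X)$ and $q\in\mathbb{I}$ put $U_q=f_U^{-1}((q,1])$. Suppose that for every decreasing (possibly transfinite) sequence $(U^\alpha)$ of regular open subsets of $X$ and all $p<q$ in $\mathbb{I}$, $$\bigcap_\alpha\operatorname{cl}(U^\alpha_q)\subseteq\Bigl(\operatorname{int}\bigcap_\alpha U^\alpha\Bigr)_p.$$ Then for every decreasing (possibly transfinite) sequence $(U^\alpha)$ of regular open subsets of $X$, with $W=\operatorname{int}\bigcap_\alpha U^\alpha$, we have $f_W(x)=\inf_\alpha f_{U^\alpha}(x)$ for every $x\in X$.
   Context: $\mathbb{I}=(0,1)\cap\mathbb{Q}$. A subset $U$ of a topological space $X$ is regular open if $U=\operatorname{int}\operatorname{cl}U$; $\operatorname{RO}(X)$ is the family of all regular open subsets of $X$. An $\operatorname{RO}(X)$-stratification of a $T_0$-space $X$ is a family of functions $\{f_U\colon U\in\operatorname{RO}(X)\}$, $f_U\colon X\to[0,1]$, such that: (1) $U=f_U^{-1}((0,1])$ for every $U\in\operatorname{RO}(X)$; (2) if $U,V\in\operatorname{RO}(X)$ and $U\subseteq V$, then $f_U(x)\leqslant f_V(x)$ for every $x\in X$; (3) each $f_U$ is continuous. For a regular open set $W$ and $p\in\mathbb{I}$, $(W)_p$ denotes $f_W^{-1}((p,1])$. *)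

(* Defs.v *)
From HB Require Import structures.
From mathcomp Require Import all_boot all_order all_algebra.
From mathcomp Require Import all_classical all_reals all_analysis.
From mathcomp Require Import wochoice.
Set Implicit Arguments.
Unset Strict Implicit.
Unset Printing Implicit Defensive.
Import Order.TTheory GRing.Theory Num.Theory.
Import numFieldNormedType.Exports.
Local Open Scope classical_set_scope.
Local Open Scope ring_scope.

(* The family {f_U : U in RO(X)} is encoded by a function on all subsets of X;
   its values at sets that are not regular open are unconstrained. *)
Definition RO_stratification (R : realType) (X : topologicalType)
    (f : set X -> X -> R) : Prop :=
  [/\ forall U, regopen U -> forall x, f U x \in `[0, 1],
      forall U, regopen U -> U = f U @^-1` `]0, 1],
      forall U V, regopen U -> regopen V -> U `<=` V ->
        forall x, f U x <= f V x &
      forall U, regopen U -> continuous (f U)].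

(* (U)_q, for rational q *)
Definition strat_level (R : realType) (X : topologicalType)
    (f : set X -> X -> R) (U : set X) (q : rat) : set X :=
  f U @^-1` `]ratr q, 1].

(* A transfinite sequence is a family indexed by a nonempty well-ordered type,
   in place of a nonzero ordinal; "decreasing" is meant in the weak sense. *)
Definition decreasing_RO_seq (X : topologicalType) (I : Type) (le : rel I)
    (U : I -> set X) : Prop :=
  [/\ inhabited I, well_order le, forall a, regopen (U a) &
      forall a b, le a b -> U b `<=` U a].

(* Hence f W is a genuine member of the stratification for
   W = int (\bigcap_a U a). *)
Lemma regopen_interior_bigcap (X : topologicalType) (I : Type)
    (U : I -> set X) :
  (forall a, regopen (U a)) -> regopen (interior (\bigcap_a U a)).
Proof.
move=> roU; rewrite /regopen eqEsubset; split.
- rewrite -open_subsetE; last exact: open_interior.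
  move=> x clx a _; rewrite -(roU a); move: x clx.
  apply: interiorS; apply: closureS.
  by apply: subset_trans (@interior_subset _ _) _; exact: bigcap_inf.
- rewrite -open_subsetE; last exact: open_interior.
  exact: subset_closure.
Qed.

(* Main.v *)
Require Import Defs.
From HB Require Import structures.
From mathcomp Require Import all_boot all_order all_algebra.
From mathcomp Require Import all_classical all_reals all_analysis.
From mathcomp Require Import wochoice.
Set Implicit Arguments.
Unset Strict Implicit.
Unset Printing Implicit Defensive.
Import Order.TTheory GRing.Theory Num.Theory.
Import numFieldNormedType.Exports.
Local Open Scope classical_set_scope.
Local Open Scope ring_scope.

(** Since [W] lies in every [U a], monotonicity of the stratification makes [f W x] a lower bound of
    the values [f (U a) x]. If it were strictly below their infimum, two rationals [p < q] would fit
    in the gap. Then [x] is in the [q]-level of every [U a], so [hf] puts it in the [p]-level of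
    [W], that is [p < f W x], contradicting the choice of [p]. *)

Theorem proposition4 (R : realType) (X : topologicalType)
    (T0X : kolmogorov_space X) (crX : completely_regular_space X)
    (f : set X -> X -> R) (fstrat : RO_stratification f)
    (hf : forall (I : Type) (le : rel I) (U : I -> set X),
        decreasing_RO_seq le U ->
        forall p q : rat, 0 < p -> p < q -> q < 1 ->
          \bigcap_a closure (strat_level f (U a) q)
            `<=` strat_level f (interior (\bigcap_a U a)) p)
    (I : Type) (le : rel I) (U : I -> set X)
    (decU : decreasing_RO_seq le U) (x : X) :
  f (interior (\bigcap_a U a)) x = inf (range (fun a : I => f (U a) x)).
Proof.
have [[a0] _ roU _] := decU; have [f01 _ fmon _] := fstrat.
set W := interior _; have roW : regopen W by exact: regopen_interior_bigcap.
have f_ge0 V : regopen V -> 0 <= f V x.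
  by move=> roV; have := f01 V roV x; rewrite in_itv /= => /andP[].
have f_le1 V : regopen V -> f V x <= 1.
  by move=> roV; have := f01 V roV x; rewrite in_itv /= => /andP[].
(* The real [inf] is meaningful only for a nonempty set bounded below: the index [a0] gives the
   first, nonnegativity of the stratification the second. *)
set S := (X in inf X); have S0 : S !=set0 by exists (f (U a0) x), a0.
have lbS : has_lbound S by exists 0 => _ [a _ <-]; exact: f_ge0.
apply/eqP; rewrite eq_le; apply/andP; split.
  apply: lb_le_inf => // _ [a _ <-]; apply: fmon => //.
  by apply: subset_trans (@interior_subset _ _) _; exact: bigcap_inf.
rewrite leNgt; apply/negP => fW_lt_inf.
(* Two rationals are taken because [hf] loses a margin in passing from level [q] to level [p]. *)
have [p] := rat_in_itvoo fW_lt_inf; rewrite in_itv /= => /andP[fW_lt_p p_lt_inf].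
have [q] := rat_in_itvoo p_lt_inf; rewrite in_itv /= => /andP[p_lt_q q_lt_inf].
have q_lt_f a : ratr q < f (U a) x.
  by apply: lt_le_trans q_lt_inf _; apply: ge_inf => //; exists a.
(* Both rationals fall in (0,1) because the gap lies between [f W x], at least 0, and [f (U a0) x],
   at most 1. *)
have p_gt0 : 0 < p by rewrite -(ltr0q R); exact: le_lt_trans (f_ge0 _ roW) _.
have q_lt1 : q < 1.
  by rewrite -(ltr_rat R) rmorph1; exact: lt_le_trans (q_lt_f a0) (f_le1 _ _).
have pq : p < q by rewrite -(ltr_rat R).
(* The point is in the level sets themselves, hence in their closures. *)
have : strat_level f W p x.
  apply: (hf _ _ _ decU _ _ p_gt0 pq q_lt1) => a _; apply: subset_closure.
  by rewrite /strat_level /= in_itv /= q_lt_f f_le1.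
by rewrite /strat_level /= in_itv /= => /andP[/(lt_trans fW_lt_p)]; rewrite ltxx.
Qed.
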